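(* Let $f\colon\mathbb N\to\mathbb U$ be a pretentious multiplicative function. If $\ell\in\mathbb N$ and $k_1,\ldots,k_\ell$ are integers such that $\sum_{j=1}^\ell k_j=0$, then the limit $$\lim_{N\to\infty}\mathbb E_{n\in[N]}\prod_{j=1}^\ell f^{k_j}(n+n_j)$$ exists for all $n_1,\ldots,n_\ell\in\mathbb Z$, where $f^k:=\overline f^{\,|k|}$ for $k<0$.
   Context: $\mathbb N=\{1,2,\ldots\}$, $\mathbb P$ is the set of primes, $\mathbb U$ is the closed complex unit disc, $[N]=\{1,\ldots,N\}$, $\mathbb E_{n\in[N]}a(n)=\frac1N\sum_{n=1}^Na(n)$. A function $f\colon\mathbb N\to\mathbb U$ is multiplicative if $f(mn)=f(m)f(n)$ whenever $(m,n)=1$; $f$ is extended to $\mathbb Z$ with values in $\mathbb U$ in an arbitrary way (this does not affect the limit), and $f^0:=1$. For multiplicative $f,g\colon\mathbb N\to\mathbb U$ let $\mathbb D^2(f,g)=\sum_{p\in\mathbb P}\frac1p\big(1-\mathrm{Re}(f(p)\overline{g(p)})\big)$ and write $f\sim g$ if $\mathbb D(f,g)<+\infty$. $f$ is pretentious if $f\sim n^{it}\cdot\chi$ for some $t\in\mathbb R$ and some primitive Dirichlet character $\chi$ (the constant $\chi=1$, with conductor $1$, is regarded as primitive). *)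

(* Defs.v *)
From HB Require Import structures.
From mathcomp Require Import all_boot all_order all_algebra.
From mathcomp Require Import complex.
From mathcomp Require Import all_classical all_reals all_analysis.

Set Implicit Arguments.
Unset Strict Implicit.
Unset Printing Implicit Defensive.

Import Order.TTheory GRing.Theory Num.Theory.
Import numFieldNormedType.Exports.

Local Open Scope ring_scope.
Local Open Scope complex_scope.

(* Arithmetic functions on {1, 2, ...} are represented by functions on nat;
   every condition bears on positive arguments only, so the value at 0 of
   such a function is irrelevant. *)

Definition unit_disc_valued (R : realType) (f : nat -> R[i]) : Prop :=
  forall n, (0 < n)%N -> `|f n| <= 1.

Definition multiplicative_fun (R : realType) (f : nat -> R[i]) : Prop :=
  forall m n, (0 < m)%N -> (0 < n)%N -> coprime m n -> f (m * n)%N = f m * f n.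

(* For f and g with values in the unit disc all terms are nonnegative, so the
   sum is a well-defined element of [0, +oo]. *)
Definition dist2 (R : realType) (f g : nat -> R[i]) : \bar R :=
  (\sum_(0 <= p <oo | prime p)
     (p%:R^-1 * (1 - complex.Re (f p * (g p)^*)))%:E)%E.

Definition dist (R : realType) (f g : nat -> R[i]) : \bar R :=
  sqrte (dist2 f g).

Definition dist_equiv (R : realType) (f g : nat -> R[i]) : Prop :=
  (dist f g < +oo)%E.

Definition dirichlet_character (R : realType) (q : nat) (chi : nat -> R[i])
    : Prop :=
  [/\ (0 < q)%N,
      forall n, chi (n + q)%N = chi n,
      forall m n, chi (m * n)%N = chi m * chi n
    & forall n, (chi n != 0) = coprime n q].

(* chi is not induced by a character of smaller modulus. For q = 1 the
   condition is vacuous, and the constant 1 is primitive. *)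
Definition primitive_character (R : realType) (q : nat) (chi : nat -> R[i])
    : Prop :=
  dirichlet_character q chi /\
  forall (d : nat) (psi : nat -> R[i]),
    (d %| q)%N -> (d < q)%N -> dirichlet_character d psi ->
    ~ (forall n, coprime n q -> chi n = psi n).

(* n^(it) = exp(i t ln n) for n >= 1 *)
Definition archimedean_character (R : realType) (t : R) (n : nat) : R[i] :=
  cos (t * ln n%:R) +i* sin (t * ln n%:R).

Definition pretentious (R : realType) (f : nat -> R[i]) : Prop :=
  exists (t : R) (q : nat) (chi : nat -> R[i]),
    primitive_character q chi /\
    dist_equiv f (fun n => archimedean_character t n * chi n).

(* z^k, with the convention z^k := (conj z)^|k| for k < 0, and z^0 = 1 even
   for z = 0; this is not the power in the field R[i]. *)
Definition conj_power (R : realType) (z : R[i]) (k : int) : R[i] :=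
  if k < 0 then z^* ^+ `|k|%N else z ^+ `|k|%N.

Definition average (R : realType) (a : nat -> R[i]) (N : nat) : R[i] :=
  N%:R^-1 * \sum_(1 <= n < N.+1) a n.

(* Main.v *)
Require Import Defs.
From HB Require Import structures.
From mathcomp Require Import all_boot all_order all_algebra.
From mathcomp Require Import complex.
From mathcomp Require Import all_classical all_reals all_analysis.
From mathcomp Require Import cyclic.
From mathcomp Require Import ring lra zify.

Set Implicit Arguments.
Unset Strict Implicit.
Unset Printing Implicit Defensive.

Import Order.TTheory GRing.Theory Num.Theory.
Import numFieldNormedType.Exports.

Local Open Scope ring_scope.
Local Open Scope complex_scope.
Local Open Scope classical_set_scope.

(** Let f be close to n^(it) chi (n), and put h (p) = f (p) times the conjugate
    of p^(it) chi (p), so that the sum of (1 - Re h (p)) / p over the primes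
    converges. Fix a large K. For most n, the part of n made of the primes up
    to K is g = gcd (n, W), where W is a high power of K!, and n / g is
    squarefree. For such n,
      f (n) = n^(it) v (n) H (n), where
      v (n) = f (g) g^(-it) chi (n / g), and
      H (n) is the product of the h (p) over the primes p > K dividing n.
    The function v is periodic, because gcd (n, W) is.

    The heart of the proof is that H concentrates, on the integers up to N,
    around a single point exp (i theta) of the unit circle, where theta is the
    sum of Im h (p) / p over the primes K < p <= sqrt N (lemma
    [concentration]). Indeed Im h (p) is of the order of the square root of
    1 - Re h (p), so replacing every h (p) by exp (i Im h (p)) is a
    second-order change, and the additive function so obtained has a small
    variance by the Turan-Kubilius inequality. Only primes up to sqrt N enter
    that inequality; an integer n <= N has at most one larger prime factor,
    and this alone bounds the contribution of the large primes. Hence f (n) is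
    close in mean to exp (i theta) n^(it) v (n) (lemma
    [pretentious_periodic_model]). The angle theta depends on N and need not
    converge as N grows, which is why f itself may have no mean value.

    In the product of the f^(k_j) (n + n_j) the assumption that the k_j sum to
    zero cancels exp (i theta), and it cancels the factors (n + n_j)^(it) up to
    o (1), since ln (n + n_j) - ln n tends to 0 (lemma [correlation_model]).
    What is left is a product of shifts of v, a periodic sequence, whose
    averages converge. So the averages of the correlation are, for every
    e > 0, eventually within e of a constant: they form a Cauchy sequence. *)

(** * The modulus and the points of the unit circle *)

(** The norm of R[i] takes its values in R[i], where the order is partial;
    estimates are carried out with the same norm seen in R. *)
Notation modulus := (@ComplexField.Normc.normc _).

Section Modulus.
Variable R : realType.
Implicit Types (z w : R[i]) (x y : R).

Lemma normE z : `|z| = (modulus z)%:C.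
Proof. by rewrite normc_def; case: z. Qed.

Lemma norm_le_modulus z x : (`|z| <= x%:C) = (modulus z <= x).
Proof. by rewrite normE lecR. Qed.

Lemma modulus_ge0 z : 0 <= modulus z.
Proof. by rewrite -lecR -normE normr_ge0. Qed.

Lemma modulus0 : modulus (0 : R[i]) = 0.
Proof. exact: ComplexField.Normc.normc0. Qed.

Lemma modulus1 : modulus (1 : R[i]) = 1.
Proof. exact: ComplexField.Normc.normc1. Qed.

Lemma modulusM z w : modulus (z * w) = modulus z * modulus w.
Proof. exact: ComplexField.Normc.normcM. Qed.

Lemma modulusX z n : modulus (z ^+ n) = modulus z ^+ n.
Proof. by elim: n => [|n IH]; rewrite ?expr0 ?modulus1 // !exprS modulusM IH. Qed.

Lemma modulusN z : modulus (- z) = modulus z.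
Proof. by apply: complexI; rewrite -!normE normrN. Qed.

Lemma modulusJ z : modulus z^*%R = modulus z.
Proof. by apply: complexI; rewrite -!normE normcJ. Qed.

Lemma modulusR x : modulus x%:C = `|x|.
Proof. by rewrite /= expr0n /= addr0 sqrtr_sqr. Qed.

Lemma modulusD z w : modulus (z + w) <= modulus z + modulus w.
Proof. by rewrite -lecR rmorphD /= -!normE ler_normD. Qed.

Lemma modulus_triangle w z1 z2 :
  modulus (z1 - z2) <= modulus (z1 - w) + modulus (w - z2).
Proof. by apply: le_trans (modulusD _ _); rewrite addrA subrK. Qed.

Lemma modulus_sum (I : Type) (r : seq I) (P : pred I) (F : I -> R[i]) :
  modulus (\sum_(i <- r | P i) F i) <= \sum_(i <- r | P i) modulus (F i).
Proof.
elim/big_ind2: _ => [|u a v b ua vb|//]; first by rewrite modulus0.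
by apply: le_trans (modulusD _ _) (lerD ua vb).
Qed.

Lemma modulus_prod_le1 (I : Type) (r : seq I) (P : pred I) (F : I -> R[i]) :
  (forall i, P i -> modulus (F i) <= 1) ->
  modulus (\prod_(i <- r | P i) F i) <= 1.
Proof.
move=> F1; elim/big_ind: _ => [|z w z1 w1|//]; first by rewrite modulus1.
by rewrite modulusM mulr_ile1 // modulus_ge0.
Qed.

Lemma modulus_Re z : `|complex.Re z| <= modulus z.
Proof. by rewrite -lecR -normE normc_ge_Re. Qed.

Lemma modulus_Im z : `|complex.Im z| <= modulus z.
Proof.
by case: z => a b /=; rewrite -sqrtr_sqr ler_wsqrtr // lerDr sqr_ge0.
Qed.

Lemma modulus_ReIm z : modulus z <= `|complex.Re z| + `|complex.Im z|.
Proof.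
case: z => a b /=; have h0 : 0 <= `|a| + `|b| by rewrite addr_ge0.
rewrite -(ger0_norm h0) -sqrtr_sqr ler_wsqrtr // sqrrD !real_normK ?num_real //.
by rewrite addrAC lerDl mulrn_wge0 // mulr_ge0.
Qed.

(** On the unit disc the product map is 1-Lipschitz for the sum of the
    distances: the factors are replaced one at a time, and the remaining ones
    do not increase the modulus. *)
Lemma modulus_prodB (I : Type) (r : seq I) (P : pred I) (F G : I -> R[i]) :
  (forall i, P i -> modulus (F i) <= 1) ->
  (forall i, P i -> modulus (G i) <= 1) ->
  modulus (\prod_(i <- r | P i) F i - \prod_(i <- r | P i) G i)
    <= \sum_(i <- r | P i) modulus (F i - G i).
Proof.
move=> F1 G1; elim: r => [|i r IH]; first by rewrite !big_nil subrr modulus0.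
rewrite !big_cons; case: ifP => // Pi.
set A := \prod_(j <- r | P j) F j; set B := \prod_(j <- r | P j) G j.
have -> : F i * A - G i * B = (F i - G i) * A + G i * (A - B) by ring.
apply: le_trans (modulusD _ _) _; rewrite !modulusM; apply: lerD.
  by rewrite ler_piMr ?modulus_ge0 // modulus_prod_le1.
by apply: le_trans IH; rewrite ler_piMl ?modulus_ge0 // G1.
Qed.

Lemma modulus_exprB z w n : modulus z <= 1 -> modulus w <= 1 ->
  modulus (z ^+ n - w ^+ n) <= n%:R * modulus (z - w).
Proof.
move=> z1 w1; rewrite -[n in X in X <= _]card_ord -!prodr_const.
apply: le_trans (modulus_prodB _ _ _) _ => //.
by rewrite big_const_ord iter_addr_0 mulr_natl.
Qed.

End Modulus.

Section Cis.
Variable R : realType.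
Implicit Types (x y : R).

Definition cis x : R[i] := cos x +i* sin x.

Lemma cis0 : cis 0 = 1.
Proof. by rewrite /cis cos0 sin0. Qed.

Lemma cisD x y : cis (x + y) = cis x * cis y.
Proof. by rewrite /cis cosD sinD; simpc; congr (_ +i* _); ring. Qed.

Lemma cisN x : cis (- x) = (cis x)^*%R.
Proof. by rewrite /cis cosN sinN. Qed.

Lemma modulus_cis x : modulus (cis x) = 1.
Proof. by rewrite /= cos2Dsin2 sqrtr1. Qed.

Lemma cisNM x : cis (- x) * cis x = 1.
Proof. by rewrite -cisD addNr cis0. Qed.

Lemma cis_sum (I : Type) (r : seq I) (P : pred I) (F : I -> R) :
  cis (\sum_(i <- r | P i) F i) = \prod_(i <- r | P i) cis (F i).
Proof. by apply: (big_morph cis cisD cis0). Qed.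

Lemma cisMn x n : cis (x *+ n) = cis x ^+ n.
Proof. by elim: n => [|n IH]; rewrite ?mulr0n ?cis0 // mulrS exprS cisD IH. Qed.

Lemma ler_sin_dist x y : `|sin x - sin y| <= `|x - y|.
Proof.
wlog xy : x y / x < y => [H|].
  by case: (ltgtP x y) => [/H//|/H|->]; rewrite ?subrr // distrC (distrC y).
have [c _ e] := @MVT_segment R sin cos x y (ltW xy)
  (fun z _ => is_derive_sin z) (continuous_subspaceT (@continuous_sin R)).
by rewrite distrC (distrC x) e normrM ler_piMl // cos_max.
Qed.

Lemma ler_cos_dist x y : `|cos x - cos y| <= `|x - y|.
Proof.
have E z : cos z = sin (z + pi / 2) by rewrite sinDpihalf.
by rewrite !E (le_trans (ler_sin_dist _ _)) // opprD addrACA subrr addr0.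
Qed.

Lemma cis_dist x y : modulus (cis x - cis y) <= 2 * `|x - y|.
Proof.
apply: le_trans (modulus_ReIm _) _ => /=.
by rewrite mulr_natl mulr2n lerD ?ler_cos_dist ?ler_sin_dist.
Qed.

Lemma ler_norm_sin x : `|sin x| <= `|x|.
Proof. by have := ler_sin_dist x 0; rewrite sin0 !subr0. Qed.

(** By the half-angle formula 1 - cos x = 2 sin (x / 2) ^ 2. *)
Lemma cos_ge_sqr x : 1 - cos x <= x ^+ 2 / 2.
Proof.
have s2 : sin (x / 2) ^+ 2 <= (x / 2) ^+ 2.
  by rewrite -real_normK ?num_real // -[leRHS]real_normK ?num_real //
    lerXn2r ?nnegrE // ler_norm_sin.
have -> : cos x = cos (x / 2) ^+ 2 *+ 2 - 1.
  by rewrite -cos_mulr2n -[_ *+ 2]mulr_natr divfK // pnatr_eq0.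
have := cos2Dsin2 (x / 2); move: s2.
move: (sin _ ^+ 2) (cos _ ^+ 2) => u v; rewrite expr_div_n.
by move: (x ^+ 2) => w *; lra.
Qed.

Lemma sin_sub_sqr x : `|x| <= 1 -> `|sin x - x| <= x ^+ 2 / 2.
Proof.
suff pos y : 0 < y -> y <= 1 -> `|sin y - y| <= y ^+ 2 / 2.
  move=> x1; case: (ltgtP 0 x) => [x0|x0|<-].
  - by apply: pos => //; rewrite -(gtr0_norm x0).
  - have nx0 : 0 < - x by rewrite oppr_gt0.
    have := pos (- x) nx0; rewrite sinN sqrrN -opprD normrN; apply.
    by rewrite -(ltr0_norm x0).
  - by rewrite sin0 subrr normr0 expr0n mul0r.
move=> y0 y1.
have dF (z : R) : z \in `]0, y[%R -> is_derive z 1 (fun z => sin z - z) (cos z - 1).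
  by move=> _; apply: is_deriveB.
have cF : {within `[0, y], continuous (fun z : R => sin z - z)}.
  apply: continuous_subspaceT => z; apply: cvgB; last exact: cvg_id.
  exact: continuous_sin.
have [c] := MVT y0 dF cF.
rewrite in_itv /= => /andP[c0 cy]; rewrite sin0 !subr0 => ->.
rewrite normrM (gtr0_norm y0) distrC ger0_norm ?subr_ge0 ?cos_le1 //.
have h : 1 - cos c <= y / 2.
  apply: le_trans (cos_ge_sqr c) _; rewrite ler_pM2r ?invr_gt0 //.
  by rewrite -[leRHS]mulr1 expr2 ler_pM // ltW // (lt_le_trans cy).
by rewrite expr2 mulrAC ler_pM2r.
Qed.

Lemma sqr_Im_le (z : R[i]) : modulus z <= 1 ->
  complex.Im z ^+ 2 <= 2 * (1 - complex.Re z).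
Proof.
move=> z1; have : modulus z ^+ 2 <= 1 by rewrite exprn_ile1 ?modulus_ge0.
case: (z) => a b /=; rewrite sqr_sqrtr ?addr_ge0 ?sqr_ge0 // => h.
by have := sqr_ge0 (1 - a); rewrite sqrrB expr1n mul1r mulr2n; lra.
Qed.

(** For a point z of the unit disc, Im z is of the order of the square root of
    the defect 1 - Re z, so z and exp (i Im z) differ by a second-order
    quantity. *)
Lemma cis_Im_approx (z : R[i]) : modulus z <= 1 ->
  modulus (z - cis (complex.Im z)) <= 4 * (1 - complex.Re z).
Proof.
move=> z1; have m := modulus_ReIm (z - cis (complex.Im z)).
have r1 := le_trans (modulus_Re z) z1; have i1 := le_trans (modulus_Im z) z1.
have s := sin_sub_sqr i1; have c := cos_ge_sqr (complex.Im z).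
have q := sqr_Im_le z1; have c1 := cos_le1 (complex.Im z).
case: z {z1} m r1 i1 s c c1 q => a b /= m r1 i1 s c c1 q.
apply: le_trans m _; rewrite (distrC b).
have a1 : a <= 1 by move: r1; rewrite ler_norml => /andP[].
have h : `|a - cos b| <= (1 - a) + (1 - cos b).
  by rewrite ler_norml; apply/andP; split; lra.
lra.
Qed.

End Cis.

(** * Divisibility by primes and the Turan-Kubilius inequality *)

Section TuranKubilius.
Variable R : realType.
Implicit Types (y : nat -> R) (P : pred nat).

Lemma natr_divn_le (N d : nat) : (N %/ d)%N%:R <= N%:R / d%:R :> R.
Proof.
case: d => [|d]; first by rewrite divn0 invr0 mulr0.
by rewrite ler_pdivlMr ?ltr0n // -natrM ler_nat leq_trunc_div.
Qed.

Lemma natr_divn_ge (N d : nat) : (0 < d)%N -> N%:R / d%:R - 1 <= (N %/ d)%N%:R :> R.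
Proof.
move=> d0; rewrite lerBlDr natr1.
by rewrite ler_pdivrMr ?ltr0n // -natrM ler_nat ltnW // ltn_ceil.
Qed.

Lemma sum_dvdn (N d : nat) :
  \sum_(1 <= n < N.+1) (d %| n)%:R = (N %/ d)%N%:R :> R.
Proof. by rewrite divn_count_dvd natr_sum. Qed.

Lemma sum_dvdn_le (N d : nat) :
  \sum_(1 <= n < N.+1) (d %| n)%:R <= N%:R / d%:R :> R.
Proof. by rewrite sum_dvdn natr_divn_le. Qed.

Lemma sum_const_upto (c : R) (N : nat) : \sum_(1 <= n < N.+1) c = N%:R * c.
Proof. by rewrite sumr_const_nat subn1 mulr_natl. Qed.

Lemma prime_inv_le2 p : prime p -> (p%:R^-1 : R) <= 2^-1.
Proof.
by move=> /prime_gt1 p1; rewrite lef_pV2 ?posrE ?ltr0n ?(ltnW p1) // ler_nat.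
Qed.

(** Divisibility by two distinct primes is nearly uncorrelated on an initial
    segment. The absolute bound 1, with no dependence on N, is what makes the
    off-diagonal part of the variance harmless for primes up to sqrt N. *)
Lemma dvdn_covariance (N p q : nat) : prime p -> prime q -> p != q ->
  `|\sum_(1 <= n < N.+1) ((p %| n)%:R - p%:R^-1) * ((q %| n)%:R - q%:R^-1)|
    <= 1 :> R.
Proof.
move=> pp pq pNq.
have cpq : coprime p q by rewrite prime_coprime // dvdn_prime2.
set a : R := p%:R^-1; set b : R := q%:R^-1.
have -> : \sum_(1 <= n < N.+1) ((p %| n)%:R - a) * ((q %| n)%:R - b)
    = (N %/ (p * q))%N%:R - (N %/ p)%N%:R * b - (N %/ q)%N%:R * a
      + N%:R * (a * b).
  rewrite -!sum_dvdn -sum_const_upto !mulr_suml -!sumrB -big_split /=.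
  apply: eq_bigr => n _; rewrite Gauss_dvd // -mulnb natrM; ring.
have a0 : 0 <= a by rewrite invr_ge0.
have b0 : 0 <= b by rewrite invr_ge0.
have a2 : a <= 2^-1 by apply: prime_inv_le2.
have b2 : b <= 2^-1 by apply: prime_inv_le2.
have pq0 : (0 < p * q)%N by rewrite muln_gt0 !prime_gt0.
have x1 := natr_divn_le N (p * q); have x2 := natr_divn_ge N pq0.
have y1 : (N %/ p)%N%:R * b <= N%:R * (a * b).
  by rewrite mulrA ler_wpM2r ?natr_divn_le.
have y2 : N%:R * (a * b) - b <= (N %/ p)%N%:R * b.
  by rewrite mulrA -[X in _ - X]mul1r -mulrBl ler_wpM2r ?natr_divn_ge ?prime_gt0.
have z1 : (N %/ q)%N%:R * a <= N%:R * (a * b).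
  by rewrite (mulrC a) mulrA ler_wpM2r ?natr_divn_le.
have z2 : N%:R * (a * b) - a <= (N %/ q)%N%:R * a.
  rewrite (mulrC a) mulrA -[X in _ - X]mul1r -mulrBl.
  by rewrite ler_wpM2r ?natr_divn_ge ?prime_gt0.
rewrite natrM invfM -/a -/b in x1 x2.
rewrite ler_norml; apply/andP; split; lra.
Qed.

Lemma dvdn_variance (N p : nat) : prime p ->
  \sum_(1 <= n < N.+1) ((p %| n)%:R - p%:R^-1) ^+ 2 <= N%:R / p%:R :> R.
Proof.
move=> pp; set a : R := p%:R^-1.
have -> : \sum_(1 <= n < N.+1) ((p %| n)%:R - a) ^+ 2
    = (N %/ p)%N%:R * (1 - 2 * a) + N%:R * a ^+ 2.
  rewrite -!sum_dvdn -(sum_const_upto (a ^+ 2)) !mulr_suml -big_split /=.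
  by apply: eq_bigr => n _; case: (p %| n)%N; rewrite /=; ring.
have a0 : 0 <= a by rewrite invr_ge0.
have a2 : 0 <= 1 - 2 * a.
  by rewrite subr_ge0 -ler_pdivlMl // mulr1; apply: prime_inv_le2.
apply: le_trans (lerD (ler_wpM2r a2 (natr_divn_le N p)) (lexx _)) _.
have h : 0 <= N%:R * a ^+ 2 by rewrite mulr_ge0 ?sqr_ge0.
have -> : N%:R / p%:R * (1 - 2 * a) = N%:R * a - 2 * (N%:R * a ^+ 2).
  by rewrite -/a; ring.
by rewrite -/a; lra.
Qed.

Lemma sum_iota_le M : (\sum_(0 <= p < M.+1) p <= M * M)%N.
Proof.
elim: M => [|M IH]; first by rewrite big_nat1.
by rewrite big_nat_recr //= (leq_trans (leq_add IH (leqnn _))) // ; nia.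
Qed.

(** Expanding both sides into double sums, it suffices that
    2 x_i x_j <= x_i^2 w_j / w_i + x_j^2 w_i / w_j, an instance of the
    arithmetic-geometric mean inequality. *)
Lemma cauchy_schwarz_inv (I : Type) (r : seq I) (P : pred I) (w x : I -> R) :
  (forall i, P i -> 0 < w i) ->
  (\sum_(i <- r | P i) x i) ^+ 2
    <= (\sum_(i <- r | P i) x i ^+ 2 / w i) * \sum_(i <- r | P i) w i.
Proof.
move=> w0.
rewrite expr2 !big_distrlr /=.
set A := \sum_(i <- r | P i) \sum_(j <- r | P j) x i ^+ 2 / w i * w j.
have AT : A = \sum_(i <- r | P i) \sum_(j <- r | P j) x j ^+ 2 / w j * w i.
  by rewrite /A exchange_big.
suff : (\sum_(i <- r | P i) \sum_(j <- r | P j) x i * x j) *+ 2 <= A + A.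
  by rewrite -mulr2n ler_pMn2r.
rewrite {2}AT /A -big_split /= -sumrMnl; apply: ler_sum => i Pi.
rewrite -big_split /= -sumrMnl; apply: ler_sum => j Pj.
have wi := w0 i Pi; have wj := w0 j Pj.
rewrite -subr_ge0.
have -> : x i ^+ 2 / w i * w j + x j ^+ 2 / w j * w i - x i * x j *+ 2
    = (x i * w j - x j * w i) ^+ 2 / (w i * w j).
  by field; rewrite !gt_eqF.
by rewrite divr_ge0 ?sqr_ge0 // mulr_ge0 // ltW.
Qed.

(** The Turan-Kubilius inequality for primes at most sqrt N: the diagonal
    contributes N times sum y_p^2 / p, and the off-diagonal terms contribute
    at most (sum |y_p|)^2, which Cauchy-Schwarz bounds by M^2 <= N times the
    same sum. *)
Lemma turan_kubilius (N M : nat) (P : pred nat) (y : nat -> R) :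
  (M * M <= N)%N -> (forall p, P p -> prime p) ->
  \sum_(1 <= n < N.+1)
     (\sum_(0 <= p < M.+1 | P p) y p * ((p %| n)%:R - p%:R^-1)) ^+ 2
  <= 2 * N%:R * \sum_(0 <= p < M.+1 | P p) y p ^+ 2 / p%:R.
Proof.
move=> MN Pp; set D := \sum_(0 <= p < _ | _) _.
pose e p n : R := (p %| n)%:R - p%:R^-1.
have -> : \sum_(1 <= n < N.+1) (\sum_(0 <= p < M.+1 | P p) y p * e p n) ^+ 2
  = \sum_(0 <= p < M.+1 | P p) \sum_(0 <= q < M.+1 | P q)
      y p * y q * \sum_(1 <= n < N.+1) e p n * e q n.
  under eq_bigr => n _ do rewrite expr2 big_distrlr /=.
  rewrite exchange_big /=; apply: eq_bigr => p _.
  rewrite exchange_big /=; apply: eq_bigr => q _.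
  by rewrite mulr_sumr; apply: eq_bigr => n _; ring.
have D0 : 0 <= D by apply: sumr_ge0 => p _; rewrite divr_ge0 ?sqr_ge0.
have offdiag : (\sum_(0 <= p < M.+1 | P p) `|y p|) ^+ 2 <= N%:R * D.
  apply: le_trans (@cauchy_schwarz_inv _ _ _ (fun p => p%:R) _ _) _.
    by move=> p /Pp /prime_gt0; rewrite ltr0n.
  rewrite mulrC.
  under [X in _ * X <= _]eq_bigr => p _ do rewrite real_normK ?num_real //.
  apply: ler_wpM2r => //; rewrite -natr_sum ler_nat (leq_trans _ MN) //.
  apply: leq_trans (sum_iota_le M); rewrite [leqRHS](bigID P) /=.
  exact: leq_addr.
have -> : 2 * N%:R * D = N%:R * D + N%:R * D by ring.
apply: le_trans (lerD offdiag (lexx _)).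
rewrite expr2 big_distrlr /= mulr_sumr -big_split /=.
rewrite big_seq_cond [leRHS]big_seq_cond.
apply: ler_sum => p /andP[pM Pq]; have pp := Pp p Pq.
have -> : N%:R * (y p ^+ 2 / p%:R)
    = \sum_(0 <= q < M.+1 | P q) (if q == p then N%:R * (y p ^+ 2 / p%:R) else 0).
  rewrite big_mkcond /= (bigD1_seq p) ?iota_uniq //= Pq eqxx.
  by rewrite big1 ?addr0 // => i /negbTE ->; rewrite if_same.
rewrite -big_split /=; apply: ler_sum => q /Pp qp.
case: (eqVneq q p) => [->|qNp].
  have -> : \sum_(1 <= n < N.+1) e p n * e p n = \sum_(1 <= n < N.+1) (e p n) ^+ 2.
    by apply: eq_bigr => n _; rewrite expr2.
  apply: le_trans (_ : N%:R * (y p ^+ 2 / p%:R) <= _); last first.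
    by rewrite lerDr mulr_ge0.
  rewrite -expr2 mulrCA; apply: ler_wpM2l; first exact: sqr_ge0.
  exact: dvdn_variance.
rewrite addr0 -[leRHS]mulr1; apply: le_trans (ler_norm _) _.
rewrite !normrM; apply: ler_wpM2l; first by rewrite mulr_ge0.
by apply: dvdn_covariance; rewrite // eq_sym.
Qed.

(** An integer n <= N < (M + 1)^2 has at most one prime factor exceeding M. As
    such a prime p has at least N / (2p) multiples up to N, summing over n
    gives the bound without any information on the distribution of primes. *)
Lemma sum_inv_large_primes (N M : nat) : (N < M.+1 * M.+1)%N ->
  \sum_(M.+1 <= p < N.+1 | prime p) (p%:R^-1 : R) <= 2.
Proof.
move=> NM; case: (posnP N) => [->|N0].
  by rewrite big_geq.
have N0' : 0 < N%:R :> R by rewrite ltr0n.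
rewrite -(ler_pM2l N0') mulr_sumr.
apply: le_trans (_ : \sum_(M.+1 <= p < N.+1 | prime p) 2 * (N %/ p)%N%:R <= _).
  rewrite big_nat_cond [leRHS]big_nat_cond; apply: ler_sum => p.
  move=> /andP[/andP[_ pN] /prime_gt0 p0].
  rewrite ler_pdivrMr ?ltr0n // -!natrM ler_nat.
  have := ltn_ceil N p0; have : (0 < N %/ p)%N by rewrite divn_gt0.
  move: (N %/ p)%N => k; nia.
rewrite -mulr_sumr mulrC ler_pM2r //.
under eq_bigr => p _ do rewrite -sum_dvdn.
rewrite exchange_big /= -[leRHS]mulr1 -sum_const_upto.
rewrite big_nat_cond [leRHS]big_nat_cond; apply: ler_sum => n.
rewrite andbT => /andP[n0 nN].
rewrite -natr_sum -[leRHS]/(1%:R) ler_nat.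
(* at most one term is nonzero: two primes above M have a product above N *)
have [/hasP[p pI /andP[pp pn]]|/hasPn H] :=
    boolP (has (fun p => prime p && (p %| n)%N) (index_iota M.+1 N.+1)); last first.
  rewrite big_seq_cond big1 // => p /andP[/H]; rewrite negb_and.
  by case: (prime p) => //= /negbTE ->.
rewrite big_mkcond (bigD1_seq p) ?iota_uniq //= pp pn big_seq_cond big1 // => q.
move=> /andP[qI qNp]; case: ifP => // qp; case: (boolP (q %| n)%N) => // qn.
have cpq : coprime q p by rewrite prime_coprime // dvdn_prime2.
have : (q * p %| n)%N by rewrite Gauss_dvd // qn pn.
move=> /(dvdn_leq n0) h.
move: pI qI; rewrite !mem_index_iota => /andP[pM _] /andP[qM _].
have := leq_mul qM pM; lia.
Qed.

End TuranKubilius.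

(** * Smooth and rough parts of an integer *)

Section RoughPart.

Lemma prime_dvdn_fact p K : prime p -> (p %| K`!)%N = (p <= K)%N.
Proof.
move=> pp; elim: K => [|K IH].
  by rewrite fact0 dvdn1 leqn0; case: p pp => [|[]].
rewrite factS Euclid_dvdM // IH; case: (ltngtP p K.+1) => [pK|pK|->].
- by rewrite -ltnS pK orbT.
- by rewrite gtnNdvd //= leqNgt (ltn_trans _ pK).
- by rewrite dvdnn.
Qed.

Lemma large_prime_Ndvdn p K A : prime p -> (K < p)%N -> ~~ (p %| K`! ^ A)%N.
Proof.
move=> pp Kp; case: A => [|A].
  by rewrite expn0 dvdn1; case: p pp {Kp} => [|[]].
by rewrite Euclid_dvdX // prime_dvdn_fact // leqNgt Kp.
Qed.

(** The gcd with K!^A replaces the K-smooth part of n because it is periodic in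
    n. The two agree as long as no A-th power of a prime p <= K divides n, for
    then K!^A contains the full power of every small prime dividing n. *)
Lemma rough_cofactor (n K A : nat) (g := gcdn n (K`! ^ A)) (m := (n %/ g)%N) :
  (0 < n)%N ->
  (forall p, prime p -> (p <= K)%N -> ~~ (p ^ A %| n)%N) ->
  (forall p, prime p -> (K < p)%N -> ~~ (p ^ 2 %| n)%N) ->
  [/\ (g * m)%N = n, coprime g m,
      forall p, prime p -> (p %| m)%N = (K < p)%N && (p %| n)%N
    & forall p, prime p -> ~~ (p ^ 2 %| m)%N].
Proof.
move=> n0 small large.
have W0 : (0 < K`! ^ A)%N by rewrite expn_gt0 fact_gt0.
have g0 : (0 < g)%N by rewrite gcdn_gt0 n0.
have gm : (g * m)%N = n by rewrite mulnC divnK // dvdn_gcdl.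
have m0 : (0 < m)%N by move: n0; rewrite -gm muln_gt0 => /andP[].
have dvdE p : prime p -> (p %| m)%N = (K < p)%N && (p %| n)%N.
  move=> pp; case: (leqP p K) => pK /=.
    apply/negbTE/negP => pm; have := small p pp pK.
    rewrite pfactor_dvdn // -ltnNge => lA.
    have pW : (p ^ logn p n %| K`! ^ A)%N.
      rewrite pfactor_dvdn // lognX (leq_trans (ltnW lA)) // leq_pmulr //.
      by rewrite logn_gt0 mem_primes pp fact_gt0 prime_dvdn_fact.
    have pg : (p ^ logn p n %| g)%N by rewrite dvdn_gcd pfactor_dvdnn pW.
    have : (p ^ (logn p n).+1 %| n)%N.
      by rewrite -[X in (_ %| X)%N]gm expnSr dvdn_mul.
    by rewrite pfactor_dvdn // ltnn.
  rewrite -[in RHS]gm Euclid_dvdM //; case: (boolP (p %| g)%N) => //=.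
  by rewrite dvdn_gcd (negbTE (large_prime_Ndvdn A pp pK)) andbF.
split=> //.
- rewrite coprime_has_primes //; apply/hasPn => p.
  rewrite mem_primes => /and3P[pp _]; rewrite dvdE // => /andP[Kp _].
  by rewrite /= mem_primes pp g0 /= dvdn_gcd negb_and orbC large_prime_Ndvdn.
- move=> p pp; apply/negP => p2m.
  have := dvdE p pp; rewrite (dvdn_trans _ p2m) ?dvdn_exp // => /esym/andP[Kp _].
  have /negP := large p pp Kp; apply.
  by rewrite -gm dvdn_mull.
Qed.

(** Induction on m, removing its smallest prime factor. Carrying the coprime
    cofactor g gives the factorisation of F (g m) with no value of F 1. *)
Lemma multiplicative_squarefree (T : comPzRingType) (F : nat -> T) (B g m : nat) :
  (forall a b, (0 < a)%N -> (0 < b)%N -> coprime a b -> F (a * b)%N = F a * F b) ->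
  (0 < g)%N -> (0 < m < B)%N -> coprime g m ->
  (forall p, prime p -> ~~ (p ^ 2 %| m)%N) ->
  F (g * m)%N = F g * \prod_(p < B | prime p && (p %| m)%N) F p.
Proof.
move=> FM g0; elim/ltn_ind: m => m IH /andP[m0 mB] cgm sf.
case: (ltngtP m 1) => [|m1|->]; first by rewrite ltnS leqNgt m0.
  have pp := pdiv_prime m1; set p := pdiv m in pp.
  have pm : (p %| m)%N := pdiv_dvd m.
  have [m' mE] : exists m', m = (m' * p)%N by exists (m %/ p)%N; rewrite divnK.
  have m'0 : (0 < m')%N by move: m0; rewrite mE muln_gt0 => /andP[].
  have pNm' : ~~ (p %| m')%N.
    by apply: contra (sf p pp) => h; rewrite mE -mulnn dvdn_mul.
  have m'm : (m' < m)%N by rewrite mE ltn_Pmulr // prime_gt1.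
  have m'B : (m' < B)%N := ltn_trans m'm mB.
  have pB : (p < B)%N by rewrite (leq_ltn_trans _ mB) // dvdn_leq.
  move: (cgm); rewrite mE coprimeMr => /andP[cgm' cgp].
  rewrite mulnA FM ?muln_gt0 ?g0 ?m'0 ?prime_gt0 //; last first.
    by rewrite coprimeMl cgp coprime_sym prime_coprime.
  rewrite IH ?m'0 ?m'B //; last first.
    by move=> r rp; apply: contra (sf r rp) => h; rewrite mE dvdn_mulr.
  rewrite -mulrA; congr (_ * _).
  rewrite [RHS](bigD1 (Ordinal pB)) /=; last by rewrite pp dvdn_mull.
  rewrite mulrC; congr (_ * _); apply: eq_bigl => r.
  rewrite -val_eqE /=; case: (boolP (prime r)) => //= rp.
  rewrite Euclid_dvdM // (dvdn_prime2 rp pp); case: eqP => [->|].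
    by rewrite andbF (negbTE pNm').
  by rewrite orbF andbT.
rewrite muln1 big_pred0 ?mulr1 // => r.
by rewrite dvdn1; case: eqP => [->|]; rewrite ?andbF.
Qed.

End RoughPart.

Section BadIntegers.
Variable R : realType.

Lemma sum_inv_sqr (K N : nat) : (0 < K)%N ->
  \sum_(K.+1 <= p < N.+1) ((p ^ 2)%N%:R^-1 : R) <= K%:R^-1.
Proof.
move=> K0; case: (leqP N K) => [NK|KN].
  by rewrite big_geq ?ltnS // invr_ge0.
(* the bound 1 / K - 1 / N is the one that goes through by induction on N *)
apply: le_trans (_ : K%:R^-1 - N%:R^-1 <= _); last by rewrite gerBl invr_ge0.
elim: N KN => // N IH; rewrite ltnS leq_eqVlt => /orP[/eqP <-|KN].
  rewrite big_nat1; have k0 : 0 < K%:R :> R by rewrite ltr0n.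
  rewrite natrX -natr1 -subr_ge0.
  have -> : K%:R^-1 - (K%:R + 1)^-1 - (K%:R + 1) ^- 2
      = K%:R^-1 / (K%:R + 1) ^+ 2 :> R.
    by field; rewrite ?gt_eqF // addr_gt0.
  by rewrite divr_ge0 ?invr_ge0 ?sqr_ge0.
rewrite big_nat_recr /=; last by rewrite ltnS ltnW.
apply: le_trans (lerD (IH KN) (lexx _)) _.
have n0 : 0 < N%:R :> R by rewrite ltr0n (leq_ltn_trans _ KN).
rewrite natrX -natr1 -subr_ge0.
have -> : K%:R^-1 - (N%:R + 1)^-1 - (K%:R^-1 - N%:R^-1 + (N%:R + 1) ^- 2)
    = N%:R^-1 / (N%:R + 1) ^+ 2 :> R.
  by field; rewrite ?gt_eqF ?addr_gt0 // ltr0n.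
by rewrite divr_ge0 ?invr_ge0 ?sqr_ge0.
Qed.

(** The number of prime powers that prevent n from splitting into a divisor of
    K!^A and a squarefree integer without prime factors up to K. As a sum of
    divisibility indicators it is easy to average, and it is at least 1 as soon
    as the splitting fails. *)
Definition obstructions (K A N n : nat) : nat :=
  (\sum_(0 <= p < K.+1 | prime p) (p ^ A %| n)
   + \sum_(K.+1 <= p < N.+1 | prime p) (p ^ 2 %| n))%N.

Lemma obstructions0 (K A N n : nat) : (0 < n <= N)%N ->
  obstructions K A N n = 0%N ->
  (forall p, prime p -> (p <= K)%N -> ~~ (p ^ A %| n)%N) /\
  (forall p, prime p -> (K < p)%N -> ~~ (p ^ 2 %| n)%N).
Proof.
move=> /andP[n0 nN] /eqP; rewrite addn_eq0 => /andP[].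
rewrite !sum_nat_seq_eq0 => /allP h1 /allP h2; split=> p pp pK.
  have := h1 p; rewrite mem_index_iota /= ltnS pK pp /= => /(_ isT).
  by case: (_ %| _)%N.
apply/negP => pn; have pN : (p < N.+1)%N.
  rewrite ltnS (leq_trans _ nN) // (leq_trans _ (dvdn_leq n0 pn)) //.
  by rewrite -mulnn leq_pmulr // prime_gt0.
by have := h2 p; rewrite mem_index_iota pK pN pp /= pn => /(_ isT).
Qed.

(** With the exponent 2K, a small prime obstructs at most N / 4^K integers, and
    (K + 1) / 4^K <= 1 / K; the large primes contribute the tail of the sum of
    1 / p^2. *)
Lemma sum_obstructions (K N : nat) : (0 < K)%N ->
  \sum_(1 <= n < N.+1) (obstructions K (K + K) N n)%:R <= N%:R * (2 / K%:R) :> R.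
Proof.
move=> K0; have k0 : 0 < K%:R :> R by rewrite ltr0n.
under eq_bigr => n _ do rewrite natrD !natr_sum.
rewrite big_split /= exchange_big [X in _ + X]exchange_big /=.
rewrite (mulrDl 1 1) mulrDr !mul1r; apply: lerD.
  apply: le_trans (_ : \sum_(0 <= p < K.+1 | prime p)
                         N%:R / (2 ^ (K + K))%N%:R <= _).
    apply: ler_sum => p pp; apply: le_trans (sum_dvdn_le R N _) _.
    rewrite ler_wpM2l // lef_pV2 ?posrE ?ltr0n ?expn_gt0 ?prime_gt0 //.
    by rewrite ler_nat leq_exp2r ?addn_gt0 ?K0 // prime_gt1.
  apply: le_trans (_ : \sum_(0 <= p < K.+1) N%:R / (2 ^ (K + K))%N%:R <= _).
    by rewrite [leRHS](bigID prime) /= lerDl sumr_ge0.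
  rewrite sumr_const_nat subn0 -[leLHS]mulr_natr -mulrA ler_wpM2l //.
  rewrite ler_pdivrMl ?ltr0n ?expn_gt0 // ler_pdivlMr // -natrM ler_nat expnD.
  by apply: leq_mul; last apply: ltnW; apply: ltn_expl.
apply: le_trans (_ : \sum_(K.+1 <= p < N.+1)
                       N%:R * (p ^ 2)%N%:R^-1 <= _); last first.
  by rewrite -mulr_sumr ler_wpM2l // sum_inv_sqr.
rewrite [leRHS](bigID prime) /=; apply: ler_wpDr.
  by apply: sumr_ge0 => p _; rewrite divr_ge0.
by apply: ler_sum => p pp; apply: sum_dvdn_le.
Qed.

End BadIntegers.

(** * Dirichlet characters and tails of convergent sums *)

Lemma periodic_mod (T : Type) (Q : nat) (v : nat -> T) :
  (forall n, v (n + Q)%N = v n) -> forall a b, a = b %[mod Q] -> v a = v b.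
Proof.
move=> per; suff E n : v n = v (n %% Q)%N by move=> a b ab; rewrite E ab -E.
rewrite {1}(divn_eq n Q) addnC; elim: (n %/ Q)%N => [|j IH].
  by rewrite mul0n addn0.
by rewrite mulSn (addnC Q) addnA per.
Qed.

Section DirichletCharacter.
Variables (R : realType) (q : nat) (chi : nat -> R[i]).
Hypothesis chiP : dirichlet_character q chi.

Lemma char_mod a b : a = b %[mod q] -> chi a = chi b.
Proof. by case: chiP => _ per _ _; apply: periodic_mod. Qed.

Lemma char1 : chi 1%N = 1.
Proof.
case: chiP => _ _ mul ne0; have := mul 1%N 1%N; rewrite muln1 => h.
have c0 : chi 1%N != 0 by rewrite ne0 coprime1n.
by apply: (mulfI c0); rewrite -h mulr1.
Qed.

Lemma charX n e : chi (n ^ e)%N = chi n ^+ e.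
Proof.
case: chiP => _ _ mul _; elim: e => [|e IH]; first by rewrite expn0 char1.
by rewrite expnS mul IH exprS.
Qed.

(** By Euler's theorem, chi n is a root of unity. *)
Lemma modulus_char_coprime n : coprime n q -> modulus (chi n) = 1.
Proof.
case: chiP => q0 _ _ _ cnq; apply/eqP.
have t0 : (0 < totient q)%N by rewrite totient_gt0.
rewrite -(@pexpr_eq1 R (modulus (chi n)) (totient q)) ?modulus_ge0 //.
by rewrite -modulusX -charX (char_mod (Euler_exp_totient cnq)) char1 modulus1.
Qed.

Lemma modulus_char_le1 n : modulus (chi n) <= 1.
Proof.
case: chiP => _ _ _ ne0; case: (boolP (coprime n q)) => cnq.
  by rewrite modulus_char_coprime.
by move: cnq; rewrite -ne0 negbK => /eqP ->; rewrite modulus0.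
Qed.

End DirichletCharacter.

Section Tails.
Variable R : realType.

Lemma summable_tail (P : pred nat) (a : nat -> R) :
  (forall n, P n -> 0 <= a n) ->
  (\sum_(0 <= n <oo | P n) (a n)%:E < +oo)%E ->
  forall e, 0 < e -> exists K0, forall K N, (K0 <= K)%N ->
    \sum_(K <= n < N | P n) a n <= e.
Proof.
move=> a0 fin e e0; pose S n := \sum_(0 <= i < n | P i) a i.
have S_le n : ((S n)%:E <= \sum_(0 <= n <oo | P n) (a n)%:E)%E.
  rewrite -sumEFin; apply: nneseries_lim_ge => i _ Pi.
  by rewrite lee_fin a0.
have fnum : (\sum_(0 <= n <oo | P n) (a n)%:E)%E \is a fin_num.
  rewrite ge0_fin_numE //; apply: le_trans (S_le 0%N).
  by rewrite /S big_geq.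
set B := fine (\sum_(0 <= n <oo | P n) (a n)%:E)%E.
have SB n : S n <= B by rewrite -lee_fin /B fineK.
have Ssup : has_sup (range S).
  by split; [exists (S 0%N); exists 0%N | exists B => _ [n _ <-]].
have [_ [K0 _ <-] SK0] := sup_adherent e0 Ssup.
exists K0 => K N K0K; case: (leqP N K) => [NK|KN].
  by rewrite big_geq // ltW.
have SN : S N <= sup (range S) by apply: ub_le_sup; [case: Ssup | exists N].
have SE : S N = S K0 + \sum_(K0 <= n < K | P n) a n + \sum_(K <= n < N | P n) a n.
  rewrite /S (@big_cat_nat _ _ _ K0) //= ?(leq_trans K0K) 1?ltnW //.
  by rewrite (@big_cat_nat _ _ _ K K0) //= ?addrA // ltnW.
have : 0 <= \sum_(K0 <= n < K | P n) a n by apply: sumr_ge0.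
move: SN SK0; rewrite SE; lra.
Qed.

End Tails.

(** * Concentration of the rough part *)

Section Concentration.
Variables (R : realType) (h : nat -> R[i]).
Hypothesis h_disc : forall p, prime p -> modulus (h p) <= 1.

Let d p := 1 - complex.Re (h p).
Let y p := complex.Im (h p).

(** The product of h over the primes p > K dividing n concentrates around the
    single point exp (i theta) of the unit circle, where theta is the sum of
    Im (h p) / p over K < p <= sqrt N. Each h p is first replaced by
    exp (i Im (h p)), at a cost of the order of the defect 1 - Re (h p); the
    product becomes the exponential of an additive function, whose variance is
    controlled by the Turan-Kubilius inequality. The point depends on N and
    need not converge as N grows. *)
Lemma concentration (K N : nat) (e : R) : 0 < e -> e <= 1 ->
  \sum_(K.+1 <= p < N.+1 | prime p) d p / p%:R <= e ^+ 2 ->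
  exists theta : R,
    \sum_(1 <= n < N.+1)
       modulus (\prod_(p < N.+1 | prime p && ((K < p)%N && (p %| n)%N)) h p
                - cis theta)
    <= 22 * e * N%:R.
Proof.
move=> e0 e1 De.
have [M MN NM] : exists2 M, (M * M <= N)%N & (N < M.+1 * M.+1)%N.
  elim: (N) => [|n [M h1 h2]]; first by exists 0%N.
  case: (ltnP n.+1 (M.+1 * M.+1)) => [|h3]; first by exists M => //; lia.
  by exists M.+1 => //; nia.
have MleN : (M <= N)%N by nia.
have eq_le (u v : R) : u = v -> u <= v by move->.
pose P p := prime p && (K < p)%N.
have Pp p : P p -> prime p by move=> /andP[].
have d0 p : prime p -> 0 <= d p.
  move=> pp; rewrite subr_ge0 (le_trans (ler_norm _)) //.
  by rewrite (le_trans (modulus_Re _)) // h_disc.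
have y2 p : prime p -> y p ^+ 2 <= 2 * d p.
  by move=> pp; apply: sqr_Im_le; apply: h_disc.
have DP : \sum_(0 <= p < N.+1 | P p) d p / p%:R <= e ^+ 2.
  apply: le_trans De; case: (leqP N K) => [NK|KN].
    rewrite big_nat_cond big_pred0 ?big_geq // => p.
    by rewrite /P leq0n /= ltnS; apply/negP => /andP[pN /andP[_ Kp]]; lia.
  rewrite (@big_cat_nat _ _ _ K.+1) //=; last exact: ltnW.
  rewrite [X in X + _]big_nat_cond big_pred0 ?add0r; last first.
    by move=> p; rewrite /P leq0n /= ltnS; apply/negP => /andP[pK /andP[_ Kp]]; lia.
  rewrite [leLHS]big_mkcond [leRHS]big_mkcond; apply: ler_sum => p _.
  rewrite /P; case: ifP => [/andP[-> _] //|_]; case: ifP => // pp.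
  by rewrite divr_ge0 ?d0.
pose y2sum a b := \sum_(a <= p < b | P p) y p ^+ 2 / p%:R.
have y2sum0 a b : 0 <= y2sum a b.
  by apply: sumr_ge0 => p _; rewrite divr_ge0 ?sqr_ge0.
have y2N : y2sum 0%N N.+1 <= 2 * e ^+ 2.
  apply: le_trans (ler_wpM2l _ DP); last by [].
  rewrite mulr_sumr; apply: ler_sum => p /Pp pp.
  by rewrite mulrA ler_wpM2r ?invr_ge0 // y2.
have y2cat : y2sum 0%N N.+1 = y2sum 0%N M.+1 + y2sum M.+1 N.+1.
  by rewrite /y2sum -big_cat_nat.
have y2M : y2sum 0%N M.+1 <= 2 * e ^+ 2 by have := y2sum0 M.+1 N.+1; lra.
have y2L : y2sum M.+1 N.+1 <= 2 * e ^+ 2 by have := y2sum0 0%N M.+1; lra.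
(* a second moment of size e^2 controls the first moment *)
have amgm (x : R) : `|x| <= e + x ^+ 2 / e.
  rewrite -(ler_pM2r e0) mulrDl divfK ?gt_eqF // -[x ^+ 2]real_normK ?num_real //.
  have := sqr_ge0 (`|x| - e); have := sqr_ge0 (`|x| + e).
  by rewrite sqrrB sqrrD !mulr2n -!expr2; move: (`|x|) => u; nra.
pose X n := \sum_(0 <= p < M.+1 | P p) y p * ((p %| n)%:R - p%:R^-1).
exists (\sum_(0 <= p < M.+1 | P p) y p / p%:R).
set theta := \sum_(0 <= p < M.+1 | P p) _.
(* T1: replacing h p by exp (i Im (h p)); T2: the deviation of the additive
   function over the primes up to M; T3: the primes above M *)
pose T1 n := 4 * \sum_(0 <= p < N.+1 | P p) d p * (p %| n)%:R.
pose T2 n := 2 * (e + X n ^+ 2 / e).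
pose T3 n := 2 * \sum_(M.+1 <= p < N.+1 | P p) `|y p| * (p %| n)%:R.
have pointwise n :
  modulus (\prod_(p < N.+1 | prime p && ((K < p)%N && (p %| n)%N)) h p - cis theta)
    <= T1 n + (T2 n + T3 n).
  rewrite -(big_mkord (fun p => prime p && ((K < p)%N && (p %| n)%N))).
  set Pn := fun p => prime p && ((K < p)%N && (p %| n)%N).
  have PnE p : Pn p = P p && (p %| n)%N by rewrite /Pn /P andbA.
  apply: le_trans (modulus_triangle (cis (\sum_(0 <= p < N.+1 | Pn p) y p)) _ _) _.
  apply: lerD.
    rewrite cis_sum; apply: le_trans (modulus_prodB _ _ _) _.
    - by move=> p /andP[/h_disc].
    - by move=> p _; rewrite modulus_cis.
    rewrite /T1 mulr_sumr (eq_bigl _ _ PnE) big_mkcondr; apply: ler_sum => p /Pp pp.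
    case: (p %| n)%N; last by rewrite !mulr0.
    by rewrite mulr1; apply: cis_Im_approx; apply: h_disc.
  apply: le_trans (cis_dist _ _) _; rewrite -mulrDr ler_wpM2l //.
  rewrite (eq_bigl _ _ PnE) big_mkcondr.
  have -> : \sum_(0 <= p < N.+1 | P p) (if (p %| n)%N then y p else 0) - theta
     = X n + \sum_(M.+1 <= p < N.+1 | P p) y p * (p %| n)%:R.
    rewrite (@big_cat_nat _ _ _ M.+1) //= addrAC /theta -sumrB; congr (_ + _).
      apply: eq_bigr => p _; case: (p %| n)%N; rewrite /=; ring.
    by apply: eq_bigr => p _; case: (p %| n)%N; rewrite ?mulr1 ?mulr0.
  apply: le_trans (ler_normD _ _) _; apply: lerD; first exact: amgm.
  apply: le_trans (ler_norm_sum _ _ _) _; apply: ler_sum => p _.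
  by rewrite normrM (ger0_norm (ler0n _ _)).
apply: le_trans (ler_sum _ (fun n _ => pointwise n)) _.
rewrite !big_split /=.
have N0 : 0 <= N%:R :> R by [].
have e2e : e ^+ 2 <= e by rewrite expr2 ler_piMr // ltW.
have S1 : \sum_(1 <= n < N.+1) T1 n <= 4 * e * N%:R.
  rewrite /T1 -mulr_sumr -mulrA ler_wpM2l // exchange_big /=.
  apply: le_trans (_ : \sum_(0 <= p < N.+1 | P p) N%:R * (d p / p%:R) <= _).
    apply: ler_sum => p /Pp pp; rewrite -mulr_sumr mulrCA ler_wpM2l ?d0 //.
    exact: sum_dvdn_le.
  by rewrite -mulr_sumr mulrC ler_wpM2r // (le_trans DP).
have S2 : \sum_(1 <= n < N.+1) T2 n <= 10 * e * N%:R.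
  rewrite /T2 -mulr_sumr big_split /= sum_const_upto -mulr_suml.
  have TK := turan_kubilius y MN Pp; rewrite -/(y2sum _ _) in TK.
  have : (\sum_(1 <= n < N.+1) X n ^+ 2) / e <= 4 * e * N%:R.
    rewrite ler_pdivrMr //; apply: le_trans TK _.
    apply: le_trans (ler_wpM2l _ y2M) _; first by rewrite mulr_ge0.
    by apply: eq_le; ring.
  move: (N%:R * e) (_ / e) (mulrC e N%:R) => u w E; rewrite -!mulrA E; lra.
have S3 : \sum_(1 <= n < N.+1) T3 n <= 8 * e * N%:R.
  rewrite /T3 -mulr_sumr exchange_big /=.
  apply: le_trans (_ : 2 * (N%:R * \sum_(M.+1 <= p < N.+1 | P p)
                         (e * p%:R^-1 + y p ^+ 2 / p%:R / e)) <= _).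
    rewrite ler_wpM2l // mulr_sumr; apply: ler_sum => p _.
    rewrite -mulr_sumr; apply: le_trans (ler_wpM2l _ (sum_dvdn_le R N p)) _ => //.
    rewrite mulrCA ler_wpM2l // -mulrA (mulrC p%:R^-1) mulrA -mulrDl.
    by rewrite ler_wpM2r ?invr_ge0.
  rewrite big_split /= -mulr_sumr -mulr_suml -/(y2sum _ _).
  have L2 : \sum_(M.+1 <= p < N.+1 | P p) (p%:R^-1 : R) <= 2.
    apply: le_trans (sum_inv_large_primes R NM).
    rewrite [leLHS]big_mkcond [leRHS]big_mkcond; apply: ler_sum => p _.
    by rewrite /P; case: (prime p) => //=; case: ifP => // _; rewrite invr_ge0.
  have h1 : y2sum M.+1 N.+1 / e <= 2 * e by rewrite ler_pdivrMr // -mulrA -expr2.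
  have h2 := ler_wpM2l (ltW e0) L2.
  have -> : 8 * e * N%:R = 2 * (N%:R * (e * 2 + 2 * e)) by ring.
  by rewrite ler_wpM2l // ler_wpM2l // lerD.
apply: le_trans (lerD S1 (lerD S2 S3)) _; apply: eq_le; ring.
Qed.

End Concentration.

(** * The periodic model of a pretentious function *)

Section PeriodicModel.
Variables (R : realType) (f : nat -> R[i]).
Hypotheses (f_disc : unit_disc_valued f) (f_mult : multiplicative_fun f).

Lemma modulus_disc n : (0 < n)%N -> modulus (f n) <= 1.
Proof. by move=> /f_disc; rewrite (norm_le_modulus _ 1). Qed.

Lemma cis_lnM (t : R) a b : (0 < a)%N -> (0 < b)%N ->
  cis (t * ln (a * b)%N%:R) = cis (t * ln a%:R) * cis (t * ln b%:R).
Proof. by move=> a0 b0; rewrite natrM lnM ?posrE ?ltr0n // mulrDr cisD. Qed.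

Section Model.
Variables (t : R) (q : nat) (chi : nat -> R[i]).
Hypothesis chiP : dirichlet_character q chi.

(** With W = K!^A, the function n^(it) model W n comes from f by keeping its
    value on the part of n made of small primes and replacing f (p) by
    p^(it) chi (p) at the large ones. *)
Definition model (W n : nat) : R[i] :=
  f (gcdn n W) * cis (- (t * ln (gcdn n W)%:R)) * chi (n %/ gcdn n W).

Lemma model_periodic (W n : nat) : (0 < W)%N ->
  model W (n + q * W) = model W n.
Proof.
move=> W0; have g0 : (0 < gcdn n W)%N by rewrite gcdn_gt0 W0 orbT.
have gE : gcdn (n + q * W) W = gcdn n W by rewrite gcdnC addnC gcdnMDl gcdnC.
rewrite /model gE; congr (_ * _).
have gW : (gcdn n W %| W)%N by rewrite dvdn_gcdr.
rewrite divnDr ?dvdn_mull // -muln_divA //.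
by apply: (char_mod chiP); rewrite addnC mulnC modnMDl.
Qed.

Lemma modulus_model (W n : nat) : (0 < W)%N -> modulus (model W n) <= 1.
Proof.
move=> W0; have g0 : (0 < gcdn n W)%N by rewrite gcdn_gt0 W0 orbT.
rewrite /model !modulusM modulus_cis mulr1 mulr_ile1 ?modulus_ge0 ?modulus_disc //.
exact: modulus_char_le1 chiP _.
Qed.

Let psi n := archimedean_character t n * chi n.
Let h p := f p * (psi p)^*.

(** On the integers that split, the passage from f to its model costs exactly
    the product of the h p over the large primes dividing n. *)
Lemma model_mul (K A N n : nat) : (q <= K)%N -> (0 < n <= N)%N ->
  obstructions K A N n = 0%N ->
  f n = cis (t * ln n%:R) * model (K`! ^ A) n
        * \prod_(p < N.+1 | prime p && ((K < p)%N && (p %| n)%N)) h p.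
Proof.
move=> qK nN /(obstructions0 nN)[small large].
case/andP: nN => n0 nN; have [q0 _ chiM _] := chiP.
have [] := rough_cofactor n0 small large.
rewrite /model; set g := gcdn n _; set m := (n %/ g)%N => gm cgm dvdE sf.
have : (0 < g * m)%N by rewrite gm.
rewrite muln_gt0 => /andP[g0 m0].
have mB : (0 < m < N.+1)%N.
  by rewrite m0 ltnS (leq_trans _ nN) // leq_div.
have psiM a b : (0 < a)%N -> (0 < b)%N -> coprime a b ->
    psi (a * b)%N = psi a * psi b.
  move=> a0 b0 _; rewrite /psi chiM /archimedean_character -!/(cis _) cis_lnM //.
  by rewrite mulrACA.
have psi1 : psi 1%N = 1.
  rewrite /psi (char1 chiP) /archimedean_character.
  by rewrite ln1 mulr0 cos0 sin0 mulr1.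
have psim := multiplicative_squarefree psiM (ltn0Sn 0) mB (coprime1n m) sf.
rewrite psi1 mul1n mul1r in psim.
have fm := multiplicative_squarefree f_mult g0 mB cgm sf.
have congrP (F : nat -> R[i]) : \prod_(p < N.+1 | prime p && (p %| m)%N) F p
    = \prod_(p < N.+1 | prime p && ((K < p)%N && (p %| n)%N)) F p.
  by apply: eq_bigl => p; case: (boolP (prime p)) => //= pp; rewrite dvdE.
rewrite -[in LHS]gm fm -[in cis _]gm cis_lnM //.
have -> : cis (t * ln g%:R) * cis (t * ln m%:R)
     * (f g * cis (- (t * ln g%:R)) * chi m)
   = f g * (cis (t * ln m%:R) * chi m).
  by rewrite -[f g in RHS]mulr1 -(cisNM (t * ln g%:R)); ring.
rewrite -[cis _ * chi m]/(psi m) psim -mulrA congrP congrP -big_split /=.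
congr (_ * _); apply: eq_bigr => p /andP[pp /andP[Kp _]].
have : modulus (psi p) = 1.
  rewrite /psi modulusM [modulus _](modulus_cis (t * ln p%:R)) mul1r.
  apply: modulus_char_coprime chiP _ _.
  by rewrite prime_coprime // gtnNdvd // (leq_ltn_trans qK).
rewrite /h mulrCA => psi_1.
have -> : psi p * (psi p)^* = 1.
  by rewrite -sqr_normc normE psi_1 expr1n.
by rewrite mulr1.
Qed.

End Model.

(** Concentration turns the product of the h p over the large primes into a
    constant exp (i theta), and the integers that do not split are too few to
    matter in mean. The order of the quantifiers is essential: theta moves with
    N, but the period and v depend on e only. *)
Lemma pretentious_periodic_model : pretentious f ->
  exists t : R, forall e, 0 < e -> exists (Q : nat) (v : nat -> R[i]),
    [/\ (0 < Q)%N, forall n, v (n + Q)%N = v n, forall n, modulus (v n) <= 1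
      & forall N, exists theta : R,
          \sum_(1 <= n < N.+1) modulus (f n - cis (theta + t * ln n%:R) * v n)
            <= e * N%:R].
Proof.
move=> [t [q [chi [[chiP _] fin]]]]; exists t => e e0.
pose psi n := archimedean_character t n * chi n.
pose h p := f p * (psi p)^*.
pose d p := 1 - complex.Re (h p).
have h_disc p : prime p -> modulus (h p) <= 1.
  move=> /prime_gt0 p0; rewrite /h modulusM modulusJ mulr_ile1 ?modulus_ge0 //.
    exact: modulus_disc.
  rewrite /psi modulusM [modulus _](modulus_cis (t * ln p%:R)) mul1r.
  exact: modulus_char_le1 chiP _.
have d0 p : prime p -> 0 <= d p.
  move=> pp; rewrite subr_ge0 (le_trans (ler_norm _)) //.
  by rewrite (le_trans (modulus_Re _)) // h_disc.
have sumfin : (\sum_(0 <= p <oo | prime p) (d p / p%:R)%:E < +oo)%E.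
  have : (dist2 f psi < +oo)%E.
    have : (sqrte (dist2 f psi) < +oo)%E := fin.
    by case: (dist2 f psi) => [r| |] //= _; rewrite ltry.
  congr (_ < _)%E; rewrite /dist2; congr (limn _); apply/funext => n.
  by apply: eq_bigr => p _; rewrite mulrC.
(* 22 e1 is lost by concentration and at most 4 e1 on the integers that do not
   split *)
pose e1 := Num.min 1 (e / 26).
have e10 : 0 < e1 by rewrite lt_min ltr01 divr_gt0.
have e11 : e1 <= 1 by rewrite ge_min lexx.
have e1e : 26 * e1 <= e by rewrite -ler_pdivlMl // mulrC ge_min lexx orbT.
have dp0 p : prime p -> 0 <= d p / p%:R by move=> pp; rewrite divr_ge0 ?d0.
have [K0 tail] := summable_tail dp0 sumfin (exprn_gt0 2 e10).
pose K := (K0 + q + (Num.truncn (4 / e1)).+1)%N.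
have K_gt0 : (0 < K)%N by rewrite /K addnS.
have Kq : (q <= K)%N by rewrite /K -addnA addnCA leq_addr.
have K4 : 4 / K%:R <= e1.
  rewrite ler_pdivrMr ?ltr0n // mulrC -ler_pdivrMr // ltW //.
  apply: lt_le_trans (truncnS_gt _) _.
  by rewrite ler_nat leq_addl.
have W0 : (0 < K`! ^ (K + K))%N by rewrite expn_gt0 fact_gt0.
exists (q * K`! ^ (K + K))%N, (model t chi (K`! ^ (K + K))); split.
- by rewrite muln_gt0 W0; case: chiP => ->.
- by move=> n; apply: model_periodic.
- by move=> n; exact: (modulus_model t chiP n W0).
move=> N.
have tailK : \sum_(K.+1 <= p < N.+1 | prime p) d p / p%:R <= e1 ^+ 2.
  by apply: tail; rewrite leqW // /K -addnA leq_addr.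
have [theta conc] := concentration h_disc e10 e11 tailK.
exists theta.
apply: le_trans (_ : \sum_(1 <= n < N.+1)
  (modulus (\prod_(p < N.+1 | prime p && ((K < p)%N && (p %| n)%N)) h p - cis theta)
   + 2 * (obstructions K (K + K) N n)%:R) <= _).
  rewrite big_nat_cond [leRHS]big_nat_cond; apply: ler_sum => n.
  rewrite andbT ltnS => nN; have /andP[n0 _] := nN.
  case: (posnP (obstructions K (K + K) N n)) => [ob|ob].
    rewrite (model_mul t chiP Kq nN ob) cisD ob mulr0 addr0.
    set c := cis (t * _); set w := model _ _ _ _; set H := \prod_(p < _ | _) _.
    have -> : c * w * H - cis theta * c * w = c * (w * (H - cis theta)) by ring.
    rewrite modulusM modulus_cis mul1r modulusM ler_piMl ?modulus_ge0 //.
    exact: (modulus_model t chiP n W0).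
  apply: ler_wpDl; first exact: modulus_ge0.
  apply: le_trans (_ : 2 <= _); last by rewrite ler_peMr // ler1n.
  apply: le_trans (modulusD _ _) _; rewrite modulusN modulusM modulus_cis mul1r.
  apply: (@lerD _ _ 1 _ 1); first exact: modulus_disc.
  exact: (modulus_model t chiP n W0).
rewrite big_split /= -mulr_sumr.
apply: le_trans (lerD conc (ler_wpM2l _ (sum_obstructions R N K_gt0))) _ => //.
have h4 : 2 * (N%:R * (2 / K%:R)) <= N%:R * e1 :> R.
  have -> : 2 * (N%:R * (2 / K%:R)) = N%:R * (4 / K%:R) :> R by ring.
  by rewrite ler_wpM2l.
have : 26 * e1 * N%:R <= e * N%:R by rewrite ler_wpM2r.
have : 0 <= e1 * N%:R by rewrite mulr_ge0 // ltW.
move: h4; rewrite -!mulrA (mulrC N%:R e1).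
by move: (e1 * _) (e * _) (2 * _) => x y z; lra.
Qed.

End PeriodicModel.

(** * Powers, averages and limits *)

Section ConjPower.
Variable R : realType.
Implicit Types (z w : R[i]) (k : int).

Lemma modulus_conj_power z k : modulus z <= 1 -> modulus (conj_power z k) <= 1.
Proof.
by move=> z1; rewrite /conj_power; case: ifP => _;
  rewrite modulusX exprn_ile1 ?modulus_ge0 ?modulusJ.
Qed.

Lemma conj_powerB z w k : modulus z <= 1 -> modulus w <= 1 ->
  modulus (conj_power z k - conj_power w k) <= `|k|%N%:R * modulus (z - w).
Proof.
move=> z1 w1; rewrite /conj_power; case: ifP => _; last exact: modulus_exprB.
rewrite -(modulusJ (z - w)) rmorphB.
by apply: modulus_exprB; rewrite modulusJ.
Qed.

Lemma conj_power_cisM x z k :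
  conj_power (cis x * z) k = cis (k%:~R * x) * conj_power z k.
Proof.
rewrite /conj_power; case: ifP => k0.
  have -> : (cis x * z)^*%R = cis (- x) * z^*%R by rewrite cisN rmorphM.
  rewrite exprMn -cisMn; congr (cis _ * _).
  rewrite -mulr_natl natr_absz ltr0_norm // mulrNz; ring.
rewrite exprMn -cisMn; congr (cis _ * _).
by rewrite -mulr_natl natr_absz ger0_norm // leNgt k0.
Qed.

End ConjPower.

Section Averages.
Variable R : realType.

(** The partial sums of a periodic sequence differ from a linear function of N
    by a periodic, hence bounded, function of N. *)
Lemma periodic_sum_linear (Q : nat) (V : nat -> R[i]) : (0 < Q)%N ->
  (forall n, V (n + Q)%N = V n) ->
  exists (L : R[i]) (C : R), forall N,
    modulus (\sum_(1 <= n < N.+1) V n - N%:R * L) <= C.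
Proof.
move=> Q0 per; pose L := (\sum_(1 <= n < Q.+1) V n) / Q%:R.
pose D N := \sum_(1 <= n < N.+1) V n - N%:R * L.
have Dper N : D (N + Q)%N = D N.
  rewrite /D (@big_cat_nat _ _ _ Q.+1) //=; last by rewrite ltnS leq_addl.
  have -> : \sum_(Q.+1 <= n < (N + Q).+1) V n = \sum_(1 <= n < N.+1) V n.
    rewrite -[Q.+1]add1n big_addn -addSn addnK.
    by apply: eq_bigr => n _; rewrite per.
  have -> : \sum_(1 <= n < Q.+1) V n = Q%:R * L.
    by rewrite mulrC divfK // pnatr_eq0 -lt0n.
  by rewrite natrD; ring.
exists L, (\sum_(i < Q) modulus (D i)) => N.
have DN : D N = D (N %% Q)%N by apply: periodic_mod Dper _ _ _; rewrite modn_mod.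
rewrite -/(D N) DN (bigD1 (Ordinal (ltn_pmod N Q0))) //= lerDl.
by apply: sumr_ge0 => i _; apply: modulus_ge0.
Qed.

(** Approximability by limits, up to any e > 0, is the Cauchy property; R[i] is
    treated through real and imaginary parts, where completeness is that of the
    real line. *)
Lemma approx_limit_cvg (u : nat -> R[i]) :
  (forall e, 0 < e -> exists (L : R[i]) (N0 : nat),
     forall N, (N0 <= N)%N -> modulus (u N - L) <= e) ->
  exists L : R[i], u @ \oo --> (L : R[i]^o).
Proof.
move=> approx.
have part (p : R[i] -> R) : (forall z w, p (z - w) = p z - p w) ->
    (forall z, `|p z| <= modulus z) -> cvg ((p \o u) @ \oo).
  move=> pB p_le; apply/cauchy_cvgP/cauchy_exP => e e0.
  have [|L [N0 LN]] := approx (e / 2); first by rewrite divr_gt0.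
  exists (p L); exists N0 => // N /= /LN h.
  rewrite /ball /= distrC -pB (le_lt_trans (p_le _)) // (le_lt_trans h) //.
  by rewrite ltr_pdivrMr // ltr_pMr // ltr1n.
have reB z w : complex.Re (z - w) = complex.Re z - complex.Re w :> R.
  by case: z w => a b [].
have imB z w : complex.Im (z - w) = complex.Im z - complex.Im w :> R.
  by case: z w => a b [].
have /cvg_ex[/= a ca] := part _ reB (@modulus_Re R).
have /cvg_ex[/= b cb] := part _ imB (@modulus_Im R).
exists (a +i* b); apply/(@cvgrPdist_le R[i] R[i]^o) => e e0.
have [e' e'0 ->] : exists2 e' : R, 0 < e' & e = e'%:C.
  exists (complex.Re e); first by move: e0; rewrite ltcE => /andP[].
  by rewrite (RRe_real (gtr0_real e0)).
have e'2 : 0 < e' / 2 by rewrite divr_gt0.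
move/cvgrPdist_le: ca => /(_ _ e'2) ca; move/cvgrPdist_le: cb => /(_ _ e'2) cb.
near=> n.
rewrite norm_le_modulus; apply: le_trans (modulus_ReIm _) _; rewrite reB imB.
have -> : e' = e' / 2 + e' / 2 by rewrite -splitr.
by apply: lerD; near: n.
Unshelve. all: by end_near. Qed.

(** Shifting by s is injective, and n > a >= |s| keeps n + s positive. *)
Lemma sum_shift_le (G : nat -> R) (a B N : nat) (s : int) :
  (forall n, 0 <= G n) -> (`|s| <= B)%N -> (B <= a)%N ->
  \sum_(a.+1 <= n < N.+1) G (absz (n%:Z + s)%R)
    <= \sum_(1 <= m < (N + B).+1) G m.
Proof.
move=> G0 sB Ba; case: (leqP N a) => [Na|aN].
  by rewrite big_geq // sumr_ge0.
pose u := absz (s + B%:Z)%R.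
have uE : u%:Z = s + B%:Z by rewrite /u gez0_abs //; lia.
have aE : a.+1 = ((a.+1 - B) + B)%N by lia.
have -> : \sum_(a.+1 <= n < N.+1) G (absz (n%:Z + s)%R)
    = \sum_((a.+1 - B) + u <= m < (N.+1 - B) + u) G m.
  rewrite aE big_addn big_addn !addnK; apply: eq_bigr => n _.
  congr G; lia.
rewrite [leRHS](@big_cat_nat _ _ _ ((a.+1 - B) + u)) /=; [|lia|lia].
rewrite [X in _ + X](@big_cat_nat _ _ _ ((N.+1 - B) + u)) /=; [|lia|lia].
by rewrite addrCA lerDl addr_ge0 // sumr_ge0.
Qed.

Lemma ln_nat_dist (n m B : nat) : (0 < B)%N -> (2 * B <= n)%N ->
  (n <= m + B)%N -> (m <= n + B)%N ->
  `|ln m%:R - ln n%:R| <= 2 * B%:R / n%:R :> R.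
Proof.
move=> B0 Bn nm mn.
have n0 : 0 < n%:R :> R by rewrite ltr0n; lia.
have m0 : 0 < m%:R :> R by rewrite ltr0n; lia.
have key (x y : R) : 0 < x -> 0 < y -> ln x - ln y <= (x - y) / y.
  move=> x0 y0; rewrite -ln_div ?posrE //.
  have := @le_ln1Dx R (x / y - 1); rewrite [1 + _]addrC subrK => h.
  rewrite mulrBl divff ?gt_eqF //; apply: h.
  by rewrite ltrBrDl addrN divr_gt0.
have B0' : 0 <= B%:R :> R by [].
have mn' : m%:R <= n%:R + B%:R :> R by rewrite -natrD ler_nat.
have nm' : n%:R <= m%:R + B%:R :> R by rewrite -natrD ler_nat.
have nm2 : n%:R <= 2 * m%:R :> R by rewrite -natrM ler_nat; lia.
rewrite ler_norml; apply/andP; split; last first.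
  apply: le_trans (key _ _ m0 n0) _; rewrite ler_pM2r ?invr_gt0 //; lra.
rewrite lerNl opprB; apply: le_trans (key _ _ n0 m0) _.
rewrite ler_pdivrMr // mulrAC ler_pdivlMr //.
apply: le_trans (_ : B%:R * n%:R <= _); first by rewrite ler_pM2r //; lra.
by rewrite mulrC -mulrA (mulrC 2) -mulrA; nra.
Qed.

End Averages.

(** * Correlations *)

Section Correlations.
Variables (R : realType) (f : nat -> R[i]) (fZ : int -> R[i]).
Hypothesis fZ_ext : forall n : nat, (0 < n)%N -> fZ n%:Z = f n.
Hypothesis fZ_disc : forall m : int, `|fZ m| <= 1.
Variables (l : nat) (k s : 'I_l -> int).
Hypothesis k_sum0 : \sum_(j < l) k j = 0.

Let F (n : nat) := \prod_(j < l) conj_power (fZ (n%:Z + s j)) (k j).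
Let kappa : R := \sum_(j < l) `|k j|%N%:R.

Lemma sum_weights0 (x : R) : \sum_(j < l) (k j)%:~R * x = 0.
Proof. by rewrite -mulr_suml -rmorph_sum k_sum0 mul0r. Qed.

Section Comparison.
Variables (t e : R) (Q : nat) (v : nat -> R[i]).
Hypotheses (e_gt0 : 0 < e) (Q_gt0 : (0 < Q)%N).
Hypotheses (v_per : forall n, v (n + Q)%N = v n)
           (v_disc : forall n, modulus (v n) <= 1).
Hypothesis v_model : forall N, exists theta : R,
  \sum_(1 <= n < N.+1) modulus (f n - cis (theta + t * ln n%:R) * v n)
    <= e * N%:R.

(** The shifts are reduced modulo Q, so that the arguments stay natural numbers
    and the product is periodic from n = 0 on. *)
Definition model_product (n : nat) : R[i] :=
  \prod_(j < l) conj_power (v (n + absz (s j %% Q)%Z)%N) (k j).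

Lemma model_product_periodic n : model_product (n + Q) = model_product n.
Proof. by apply: eq_bigr => j _; rewrite addnAC v_per. Qed.

(** Because the k j sum to zero, the constant theta and the main part t ln n of
    each phase theta + t ln (n + s j) cancel in the product; what remains of
    the phases is O (1 / n). *)
Lemma correlation_pointwise (theta : R) (B n : nat) :
  (0 < B)%N -> (forall j, (`|s j| <= B)%N) -> (2 * B <= n)%N ->
  modulus (F n - model_product n)
    <= \sum_(j < l) `|k j|%N%:R
         * modulus (f (absz (n%:Z + s j)%R)
                    - cis (theta + t * ln (absz (n%:Z + s j)%R)%:R)
                      * v (absz (n%:Z + s j)%R))
       + 4 * kappa * `|t| * B%:R / n%:R.
Proof.
move=> B0 sB Bn; pose m j := absz (n%:Z + s j)%R.
have mE j : (m j)%:Z = n%:Z + s j by have := sB j; rewrite /m; lia.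
have m0 j : (0 < m j)%N by have := sB j; have := mE j; lia.
have fm j : f (m j) = fZ (n%:Z + s j) by rewrite -mE fZ_ext.
have mQ j : v (n + absz (s j %% Q)%Z)%N = v (m j).
  apply: periodic_mod v_per _ _ _; apply/eqP; rewrite -eqz_nat -!modz_nat PoszD.
  rewrite gez0_abs ?modz_ge0 ?eqz_nat -?lt0n //.
  by rewrite modzDmr mE.
pose al j := theta + t * ln (m j)%:R.
pose U := \prod_(j < l) conj_power (cis (al j) * v (m j)) (k j).
have cv1 j : modulus (cis (al j) * v (m j)) <= 1.
  by rewrite modulusM modulus_cis mul1r.
have fz1 j : modulus (fZ (n%:Z + s j)) <= 1 by rewrite -norm_le_modulus.
apply: le_trans (modulus_triangle U _ _) _; apply: lerD.
  apply: le_trans (modulus_prodB _ _ _) _.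
  - by move=> j _; apply: modulus_conj_power.
  - by move=> j _; apply: modulus_conj_power.
  apply: ler_sum => j _; apply: le_trans (conj_powerB _ _ _) _ => //.
  by rewrite -/(m j) fm.
have UE : U = cis (\sum_(j < l) (k j)%:~R * al j) * model_product n.
  rewrite cis_sum -big_split /=; apply: eq_bigr => j _.
  by rewrite conj_power_cisM mQ.
have phase : \sum_(j < l) (k j)%:~R * al j
    = \sum_(j < l) (k j)%:~R * (t * (ln (m j)%:R - ln n%:R)).
  apply/eqP; rewrite -subr_eq0 -sumrB.
  rewrite -[eqbRHS](sum_weights0 (theta + t * ln n%:R)); apply/eqP.
  by apply: eq_bigr => j _; rewrite /al; ring.
rewrite UE -[X in _ - X]mul1r -mulrBl modulusM.
apply: le_trans (ler_piMr (modulus_ge0 _) _) _.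
  by apply: modulus_prod_le1 => j _; apply: modulus_conj_power.
rewrite -(cis0 R); apply: le_trans (cis_dist _ _) _; rewrite subr0 phase.
apply: le_trans (ler_wpM2l _ (ler_norm_sum _ _ _)) _ => //.
have -> : 4 * kappa * `|t| * B%:R / n%:R
    = 2 * \sum_(j < l) `|k j|%N%:R * (`|t| * (2 * B%:R / n%:R)).
  by rewrite -mulr_suml -/kappa; ring.
rewrite ler_wpM2l //; apply: ler_sum => j _.
have kE : `|k j|%N%:R = `|(k j)%:~R| :> R by rewrite natr_absz intr_norm.
rewrite !normrM kE ler_wpM2l // ler_wpM2l //.
by apply: ln_nat_dist => //; have := sB j; have := mE j; lia.
Qed.

Lemma correlation_model : exists N0, forall N, (N0 <= N)%N ->
  modulus (\sum_(1 <= n < N.+1) F n - \sum_(1 <= n < N.+1) model_product n)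
    <= (kappa + 2) * e * N%:R.
Proof.
have kappa0 : 0 <= kappa by apply: sumr_ge0.
pose B := (\sum_(j < l) `|s j|).+1%N.
have sB j : (`|s j| <= B)%N by rewrite leqW // (bigD1 j) //= leq_addr.
(* beyond N1 the phase error is at most e; beyond N0 the boundary terms are *)
pose N1 := (2 * B + (Num.truncn (4 * kappa * `|t| * B%:R / e)).+1)%N.
pose N0 := (N1 + (Num.truncn ((2 * N1%:R + kappa * e * B%:R) / e)).+1)%N.
exists N0 => N N0N.
have N1N : (N1 <= N)%N by rewrite (leq_trans _ N0N) // leq_addr.
have Nlarge : 2 * N1%:R + kappa * e * B%:R <= e * N%:R.
  rewrite -ler_pdivrMl // mulrC ltW //; apply: lt_le_trans (truncnS_gt _) _.
  by rewrite ler_nat (leq_trans _ N0N) // leq_addl.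
have [theta model_N] := v_model (N + B).
pose G m := modulus (f m - cis (theta + t * ln m%:R) * v m).
have F1 n : modulus (F n) <= 1.
  apply: modulus_prod_le1 => j _; apply: modulus_conj_power.
  by rewrite -norm_le_modulus.
have V1 n : modulus (model_product n) <= 1.
  by apply: modulus_prod_le1 => j _; apply: modulus_conj_power.
rewrite -sumrB; apply: le_trans (modulus_sum _ _ _) _.
rewrite (@big_cat_nat _ _ _ N1.+1) //=.
have head : \sum_(1 <= n < N1.+1) modulus (F n - model_product n) <= N1%:R * 2.
  rewrite -sum_const_upto; apply: ler_sum => n _.
  by apply: le_trans (modulusD _ _) _; rewrite modulusN (@lerD _ _ 1 _ 1).
have tail : \sum_(N1.+1 <= n < N.+1) modulus (F n - model_product n)
    <= kappa * (e * (N + B)%N%:R) + e * N%:R.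
  apply: le_trans (_ : \sum_(N1.+1 <= n < N.+1)
     (\sum_(j < l) `|k j|%N%:R * G (absz (n%:Z + s j)%R) + e) <= _).
    rewrite big_nat_cond [leRHS]big_nat_cond; apply: ler_sum => n.
    rewrite andbT => /andP[nN1 _].
    have n0 : 0 < n%:R :> R by rewrite ltr0n (leq_trans _ nN1).
    apply: le_trans (correlation_pointwise theta _ sB _) _ => //.
      by rewrite (leq_trans _ (ltnW nN1)) // leq_addr.
    rewrite lerD2l ler_pdivrMr // -ler_pdivrMl // [leLHS]mulrC ltW //.
    apply: lt_le_trans (truncnS_gt _) _.
    by rewrite ler_nat (leq_trans _ (ltnW nN1)) // leq_addl.
  rewrite big_split /=; apply: lerD; last first.
    rewrite sumr_const_nat -[leLHS]mulr_natr; apply: ler_wpM2l; first exact: ltW.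
    by rewrite ler_nat leq_subLR; lia.
  rewrite exchange_big /= /kappa mulr_suml; apply: ler_sum => j _.
  rewrite -mulr_sumr ler_wpM2l //; apply: le_trans _ model_N.
  apply: sum_shift_le => // [m|]; first exact: modulus_ge0.
  by rewrite /N1; lia.
apply: le_trans (lerD head tail) _; rewrite natrD.
have -> : kappa * (e * (N%:R + B%:R)) = kappa * e * N%:R + kappa * e * B%:R by ring.
have -> : (kappa + 2) * e * N%:R = kappa * e * N%:R + 2 * (e * N%:R) by ring.
move: Nlarge; move: (kappa * e * _) (kappa * e * _) (e * _) => x y z; lra.
Qed.

End Comparison.
End Correlations.

(** * Convergence of the correlations *)

(* fZ is an arbitrary extension of f to the integers with values in the unit
   disc. *)
Theorem theorem2p14 (R : realType) (f : nat -> R[i]) (fZ : int -> R[i])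
    (f_disc : unit_disc_valued f) (f_mult : multiplicative_fun f)
    (f_pret : pretentious f)
    (fZ_ext : forall n : nat, (0 < n)%N -> fZ n%:Z = f n)
    (fZ_disc : forall m : int, `|fZ m| <= 1)
    (l : nat) (l_gt0 : (0 < l)%N) (k : 'I_l -> int)
    (k_sum0 : \sum_(j < l) k j = 0) (s : 'I_l -> int) :
  exists L : R[i],
    average (fun n : nat => \prod_(j < l) conj_power (fZ (n%:Z + s j)) (k j))
      @ \oo --> (L : R[i]^o).
Proof.
have [t model_f] := pretentious_periodic_model f_disc f_mult f_pret.
apply: approx_limit_cvg => e e0.
pose kappa : R := \sum_(j < l) `|k j|%N%:R.
have kappa2 : 0 < kappa + 2 by rewrite ltr_wpDl ?sumr_ge0.
have e1_gt0 : 0 < e / 2 / (kappa + 2) by rewrite !divr_gt0.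
have [Q [v [Q0 v_per v_disc v_model]]] := model_f _ e1_gt0.
have [N0 cmp] :=
  correlation_model fZ_ext fZ_disc s k_sum0 e1_gt0 Q0 v_per v_disc v_model.
have [L [C VL]] := periodic_sum_linear Q0 (model_product_periodic k s v_per).
exists L, (N0 + (Num.truncn (C / (e / 2))).+1)%N => N NN.
have N_gt0 : 0 < N%:R :> R by rewrite ltr0n (leq_trans _ NN) // addnS.
have CN : C <= e / 2 * N%:R.
  rewrite -ler_pdivrMl ?divr_gt0 // mulrC ltW //.
  apply: lt_le_trans (truncnS_gt _) _.
  by rewrite ler_nat (leq_trans _ NN) // leq_addl.
have N0N : (N0 <= N)%N by rewrite (leq_trans _ NN) // leq_addr.
have NC : N%:R != 0 :> R[i] by rewrite pnatr_eq0 -lt0n -(ltr0n R).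
rewrite /average -[X in _ - X](mulKf NC) -mulrBr modulusM.
have -> : modulus (N%:R^-1 : R[i]) = N%:R^-1.
  by rewrite -(rmorph_nat (real_complex R)) -fmorphV modulusR ger0_norm // invr_ge0.
rewrite ler_pdivrMl // [leRHS]mulrC.
pose VN := \sum_(1 <= n < N.+1) model_product k s Q v n.
apply: le_trans (modulus_triangle VN _ _) _.
apply: le_trans (lerD (cmp _ N0N) (VL N)) _.
rewrite -/kappa (mulrC (kappa + 2)) divfK ?gt_eqF //.
have -> : e * N%:R = e / 2 * N%:R + e / 2 * N%:R by rewrite -mulrDl -splitr.
by rewrite lerD2l.
Qed.
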